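(* Let $\mathcal A$ be a $^*$-algebra over $\mathsf C$ with an approximate identity, let $\mathcal B$ be a $^*$-algebra over $\mathsf C$, and suppose $\Phi:\mathcal B\to\mathcal A$ is an isomorphism of $^*$-algebras. Then $\mathcal A$ and $\mathcal B$ are formally Morita equivalent. In particular, $\mathcal A$ is formally Morita equivalent to itself.
   Context: $\mathsf R$ is an ordered ring (commutative ring with $1\ne0$ and a subset $\mathsf P$ closed under sums and products such that $\mathsf R$ is the disjoint union $-\mathsf P\cup\{0\}\cup\mathsf P$), and $\mathsf C=\mathsf R(\mathrm i)=\mathsf R\oplus\mathrm i\mathsf R$, $\mathrm i^2=-1$, with the usual conjugation. A $^*$-algebra over $\mathsf C$ is an associative (not necessarily unital) $\mathsf C$-algebra with an antilinear involution satisfying $(AB)^*=B^*A^*$. A linear $\omega:\mathcal A\to\mathsf C$ is positive if $\omega(A^*A)\ge0$ for all $A$; a Hermitian $A$ is positive ($A\ge0$) if $\omega(A)\ge0$ for all positive linear functionals $\omega$. A pre-Hilbert space over $\mathsf C$ is a $\mathsf C$-module with a Hermitian inner product (linear in the second argument), $\langle\phi,\phi\rangle\ge0$, and $\langle\phi,\phi\rangle=0\Rightarrow\phi=0$. A $^*$-representation is a $^*$-homomorphism into the adjointable endomorphisms of a pre-Hilbert space. An approximate identity of $\mathcal A$ is a family $\{\mathcal A_\alpha,E_\alpha\}_{\alpha\in I}$, $I$ directed, with $E_\alpha=E_\alpha^*\in\mathcal A$, $E_\alpha=E_\alpha E_\beta=E_\beta E_\alpha$ for $\alpha<\beta$, submodules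 $\mathcal A_\alpha\subseteq\mathcal A_\beta$ for $\alpha\le\beta$, $\bigcup_\alpha\mathcal A_\alpha=\mathcal A$, and $E_\alpha A=A=AE_\alpha$ for $A\in\mathcal A_\alpha$. A $(\mathcal B$-$\mathcal A)$-equivalence bimodule is a $\mathsf C$-module $\mathfrak X$ with commuting left $\mathcal B$- and right $\mathcal A$-actions and maps $\langle\cdot,\cdot\rangle_{\mathcal A}:\mathfrak X\times\mathfrak X\to\mathcal A$, ${}_{\mathcal B}\langle\cdot,\cdot\rangle:\mathfrak X\times\mathfrak X\to\mathcal B$ such that: E1) X1) $\langle\cdot,\cdot\rangle_{\mathcal A}$ is $\mathsf C$-linear in the second argument; X2) $\langle x,y\rangle_{\mathcal A}=\langle y,x\rangle_{\mathcal A}^*$; X3) $\langle x,y\cdot A\rangle_{\mathcal A}=\langle x,y\rangle_{\mathcal A}A$; X4) $\langle x,x\rangle_{\mathcal A}\ge0$; X5) $\langle x,B\cdot y\rangle_{\mathcal A}=\langle B^*\cdot x,y\rangle_{\mathcal A}$; X6) the $\mathsf C$-span of all $\langle x,y\rangle_{\mathcal A}$ is $\mathcal A$. E2) Y1) ${}_{\mathcal B}\langle\cdot,\cdot\rangle$ is $\mathsf C$-linear in the first argument; Y2) ${}_{\mathcal B}\langle x,y\rangle={}_{\mathcal B}\langle y,x\rangle^*$; Y3) ${}_{\mathcal B}\langle B\cdot x,y\rangle=B\,{}_{\mathcal B}\langle x,y\rangle$; Y4) ${}_{\mathcal B}\langle x,x\rangle\ge0$; Y5) ${}_{\mathcal B}\langle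 x\cdot A,y\rangle={}_{\mathcal B}\langle x,y\cdot A^*\rangle$; Y6) the $\mathsf C$-span of all ${}_{\mathcal B}\langle x,y\rangle$ is $\mathcal B$. E3) ${}_{\mathcal B}\langle x,y\rangle\cdot z=x\cdot\langle y,z\rangle_{\mathcal A}$. E4) P): for every $^*$-representation $(\mathfrak H,\pi)$ of $\mathcal A$ the form $\langle x\otimes\psi,y\otimes\phi\rangle=\langle\psi,\pi(\langle x,y\rangle_{\mathcal A})\phi\rangle$ on $\mathfrak X\otimes_{\mathcal A}\mathfrak H$ is positive semi-definite; and Q): P holds for the conjugate $(\mathcal A$-$\mathcal B)$-bimodule $\overline{\mathfrak X}$ (conjugate $\mathsf C$-module, $A\bar x=\overline{xA^*}$, $\bar xB=\overline{B^*x}$) with $\langle\bar x,\bar y\rangle_{\mathcal B}={}_{\mathcal B}\langle x,y\rangle$. $\mathcal A$ and $\mathcal B$ are formally Morita equivalent if a $(\mathcal B$-$\mathcal A)$-equivalence bimodule exists. *)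

(* Defs.v *)
From HB Require Import structures.
From mathcomp Require Import all_boot all_order all_algebra.
From mathcomp Require Import boolp complex ring.

Set Implicit Arguments.
Unset Strict Implicit.
Unset Printing Implicit Defensive.

Import Order.TTheory GRing.Theory Num.Theory.
Local Open Scope ring_scope.
Local Open Scope quotient_scope.

(* An ordered ring (commutative, 1 != 0, split by a positive cone closed under
   sums and products) has no zero divisors, so up to classical logic it is the
   same thing as a realDomainType, with positive cone {x | 0 < x}. *)

(* The library only equips R[i] with its ring structure when R is a field;
   [cplx R] is a copy of R[i] that is a ring for every ordered ring R. *)
Definition cplx (R : realDomainType) : Type := R[i].

Section Cplx.
Variable R : realDomainType.

HB.instance Definition _ := GRing.Zmodule.copy (cplx R) R[i].

Definition cplx_one : cplx R := Complex 1 0.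
Definition cplx_mul (x y : cplx R) : cplx R := mulc x y.
Definition cplx_conj (x : cplx R) : cplx R := conjc x.

Let mulA : associative cplx_mul.
Proof. by move=> [a b] [c d] [e f]; congr Complex; ring. Qed.

Let mulC : commutative cplx_mul.
Proof. by move=> [a b] [c d]; congr Complex; ring. Qed.

Let mul1x : left_id cplx_one cplx_mul.
Proof. by move=> [a b]; congr Complex; ring. Qed.

Let mulDl : left_distributive cplx_mul +%R.
Proof. by move=> [a b] [c d] [e f]; congr Complex; ring. Qed.

Let one_neq0 : cplx_one != 0.
Proof. by apply/eqP=> -[/eqP]; rewrite oner_eq0. Qed.

HB.instance Definition _ :=
  GRing.Zmodule_isComNzRing.Build (cplx R) mulA mulC mul1x mulDl one_neq0.

(* z >= 0 in C means that z lies in R and is >= 0 there. *)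
Definition cplx_ge0 (z : cplx R) : Prop := complex.Im z = 0 /\ 0 <= complex.Re z.

Lemma cplx_conjD (z w : cplx R) : cplx_conj (z + w) = cplx_conj z + cplx_conj w.
Proof. by case: z w => [a b] [c d]; congr Complex; ring. Qed.

Lemma cplx_conjM (z w : cplx R) : cplx_conj (z * w) = cplx_conj z * cplx_conj w.
Proof. by case: z w => [a b] [c d]; congr Complex; ring. Qed.

Lemma cplx_conj1 : cplx_conj 1 = 1 :> cplx R.
Proof. by congr Complex; ring. Qed.

End Cplx.

(* Associative, not necessarily unital. *)
HB.mixin Record Lmodule_isStarAlgebra (R : realDomainType) A
    of GRing.Lmodule (cplx R) A := {
  smul : A -> A -> A;
  star : A -> A;
  smulA : associative smul;
  smulDl : left_distributive smul +%R;
  smulDr : right_distributive smul +%R;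
  smulZl : forall (c : cplx R) (a b : A), smul (c *: a) b = c *: smul a b;
  smulZr : forall (c : cplx R) (a b : A), smul a (c *: b) = c *: smul a b;
  starD : forall a b : A, star (a + b) = star a + star b;
  starZ : forall (c : cplx R) (a : A), star (c *: a) = cplx_conj c *: star a;
  starK : involutive star;
  starM : forall a b : A, star (smul a b) = smul (star b) (star a)
}.

#[short(type="starAlgType")]
HB.structure Definition StarAlgebra (R : realDomainType) :=
  {A of GRing.Lmodule (cplx R) A & Lmodule_isStarAlgebra R A}.

Notation "a ** b" := (smul a b) (at level 40, left associativity) : ring_scope.
Notation "a ^†" := (star a) (at level 2, format "a ^†") : ring_scope.

Section StarAlgebras.
Variable R : realDomainType.
Notation C := (cplx R).

Definition star_isomorphism (B A : starAlgType R) (f : {linear B -> A}) : Prop :=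
  [/\ bijective f,
      forall b b', f (b ** b') = f b ** f b' &
      forall b, f b^† = (f b)^†].

Definition positive_functional (A : starAlgType R) (w : {scalar A}) : Prop :=
  forall a, cplx_ge0 (w (a^† ** a)).

Definition positive_element (A : starAlgType R) (a : A) : Prop :=
  a^† = a /\ forall w : {scalar A}, positive_functional w -> cplx_ge0 (w a).

Record approximate_identity (A : starAlgType R) d (I : preorderType d)
    (S : I -> {pred A}) (E : I -> A) : Prop := {
  ai_inhabited : inhabited I;
  ai_directed : forall i j : I, exists k, (i <= k)%O /\ (j <= k)%O;
  ai_herm : forall i, E i = (E i)^†;
  ai_mul : forall i j, (i < j)%O -> E i = E i ** E j /\ E i = E j ** E i;
  ai_submod : forall i, GRing.submod_closed (S i);
  ai_mono : forall i j, (i <= j)%O -> {subset S i <= S j};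
  ai_cover : forall a, exists i, a \in S i;
  ai_unit : forall i a, a \in S i -> E i ** a = a /\ a = a ** E i
}.

Definition has_approximate_identity (A : starAlgType R) : Prop :=
  exists (d : Order.disp_t) (I : preorderType d) (S : I -> {pred A}) (E : I -> A),
    approximate_identity S E.

Record hermitian_form (H : lmodType C) (h : H -> H -> C) : Prop := {
  hf_linear : forall u, scalar (h u);
  hf_herm : forall u v, h u v = cplx_conj (h v u)
}.

Definition positive_semidefinite (H : lmodType C) (h : H -> H -> C) : Prop :=
  hermitian_form h /\ forall u, cplx_ge0 (h u u).

Record preHilbert := PreHilbert {
  ph_space :> lmodType C;
  ph_ip : ph_space -> ph_space -> C;
  ph_psd : positive_semidefinite ph_ip;
  ph_definite : forall u, ph_ip u u = 0 -> u = 0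
}.

Definition is_adjoint (H : preHilbert) (f g : H -> H) : Prop :=
  forall u v, ph_ip (f u) v = ph_ip u (g v).

Record starRep (A : starAlgType R) (H : preHilbert) := StarRep {
  rep_fun :> A -> {linear H -> H};
  rep_linear : forall (c : C) a b u,
    rep_fun (c *: a + b) u = c *: rep_fun a u + rep_fun b u;
  rep_mul : forall a b u, rep_fun (a ** b) u = rep_fun a (rep_fun b u);
  rep_star : forall a, is_adjoint (rep_fun a) (rep_fun a^†)
}.

End StarAlgebras.

(* X (x)_A H, built from formal sums of pure tensors modulo the smallest
   congruence making them biadditive, K-balanced and A-balanced. *)
Section Tensor.
Variables (K : comNzRingType) (A : Type) (X H : lmodType K).
Variables (ract : X -> A -> X) (lact : A -> {linear H -> H}).

Inductive tensor_eq : seq (X * H) -> seq (X * H) -> Prop :=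
| te_refl s : tensor_eq s s
| te_sym s t : tensor_eq s t -> tensor_eq t s
| te_trans s t u : tensor_eq s t -> tensor_eq t u -> tensor_eq s u
| te_cat s s' t t' : tensor_eq s s' -> tensor_eq t t' -> tensor_eq (s ++ t) (s' ++ t')
| te_catC s t : tensor_eq (s ++ t) (t ++ s)
| te_0l u : tensor_eq [:: (0, u)] [::]
| te_Dl x y u : tensor_eq [:: (x + y, u)] [:: (x, u); (y, u)]
| te_Dr x u v : tensor_eq [:: (x, u + v)] [:: (x, u); (x, v)]
| te_scale (c : K) x u : tensor_eq [:: (c *: x, u)] [:: (x, c *: u)]
| te_act a x u : tensor_eq [:: (ract x a, u)] [:: (x, lact a u)].

Definition tensor_eqb (s t : seq (X * H)) : bool := `[< tensor_eq s t >].

Let tensor_eqb_refl : reflexive tensor_eqb.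
Proof. by move=> s; apply/asboolP/te_refl. Qed.

Let tensor_eqb_sym : symmetric tensor_eqb.
Proof. by move=> s t; apply/asboolP/asboolP; apply: te_sym. Qed.

Let tensor_eqb_trans : transitive tensor_eqb.
Proof. by move=> s t u /asboolP st /asboolP tu; apply/asboolP; apply: te_trans tu. Qed.

Canonical tensor_equiv :=
  EquivRel tensor_eqb tensor_eqb_refl tensor_eqb_sym tensor_eqb_trans.

Definition tensor : Type := {eq_quot tensor_equiv}.
HB.instance Definition _ := Choice.on tensor.
HB.instance Definition _ := Quotient.on tensor.

Definition tensor_class (s : seq (X * H)) : tensor := \pi_tensor s.
Definition tensor_pure (x : X) (u : H) : tensor := tensor_class [:: (x, u)].

Lemma tensor_classP s t : tensor_class s = tensor_class t <-> tensor_eq s t.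
Proof. by split=> [/eqquotP /asboolP | st]; last by apply/eqquotP/asboolP. Qed.

Lemma tensor_classK (p : tensor) : tensor_class (repr p) = p.
Proof. exact: reprK. Qed.

Lemma tensor_repr s : tensor_eq (repr (tensor_class s)) s.
Proof. by apply/tensor_classP; rewrite tensor_classK. Qed.

Definition scale_seq (c : K) (s : seq (X * H)) := [seq (p.1, c *: p.2) | p <- s].

Definition tensor_zero : tensor := tensor_class [::].
Definition tensor_add (p q : tensor) : tensor := tensor_class (repr p ++ repr q).
Definition tensor_scale (c : K) (p : tensor) : tensor :=
  tensor_class (scale_seq c (repr p)).
Definition tensor_opp (p : tensor) : tensor := tensor_scale (-1) p.

Lemma scale_seq_eq c s t : tensor_eq s t -> tensor_eq (scale_seq c s) (scale_seq c t).
Proof.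
elim=> {s t}.
- by move=> s; apply: te_refl.
- by move=> s t _; apply: te_sym.
- by move=> s t u _ st _; apply: te_trans.
- by move=> s s' t t' _ ss' _ tt'; rewrite /scale_seq !map_cat; apply: te_cat.
- by move=> s t; rewrite /scale_seq !map_cat; apply: te_catC.
- by move=> u; apply: te_0l.
- by move=> x y u; apply: te_Dl.
- by move=> x u v /=; rewrite scalerDr; apply: te_Dr.
- by move=> d x u /=; rewrite scalerA mulrC -scalerA; apply: te_scale.
- by move=> a x u /=; rewrite -linearZ; apply: te_act.
Qed.

Lemma tensor_class_cat s t :
  tensor_add (tensor_class s) (tensor_class t) = tensor_class (s ++ t).
Proof. by apply/tensor_classP; apply: te_cat; apply: tensor_repr. Qed.

Lemma tensor_class_scale c s :
  tensor_scale c (tensor_class s) = tensor_class (scale_seq c s).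
Proof. by apply/tensor_classP/scale_seq_eq/tensor_repr. Qed.

Let addA : associative tensor_add.
Proof.
move=> p q r; rewrite -(tensor_classK p) -(tensor_classK q) -(tensor_classK r).
by rewrite !tensor_class_cat catA.
Qed.

Let addC : commutative tensor_add.
Proof. by move=> p q; apply/tensor_classP/te_catC. Qed.

Let add0 : left_id tensor_zero tensor_add.
Proof. by move=> p; rewrite -(tensor_classK p) tensor_class_cat. Qed.

Let scaleDl p : {morph tensor_scale^~ p : c d / c + d >-> tensor_add c d}.
Proof.
move=> c d; rewrite -(tensor_classK p) !tensor_class_scale tensor_class_cat.
apply/tensor_classP; elim: (repr p) => [|[x u] s IHs] /=; first exact: te_refl.
rewrite scalerDl -cat1s; apply: te_trans (te_cat (te_Dr _ _ _) IHs) _ => /=.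
rewrite -[X in tensor_eq X _]cat1s -[X in tensor_eq _ X]cat1s.
apply: te_cat; first exact: te_refl.
rewrite -[X in tensor_eq X _]cat1s -[(x, d *: u) :: _ in X in tensor_eq _ X]cat1s !catA.
by apply: te_cat; [apply: te_catC | apply: te_refl].
Qed.

Let scale0 p : tensor_scale 0 p = tensor_zero.
Proof.
rewrite -(tensor_classK p) tensor_class_scale; apply/tensor_classP.
elim: (repr p) => [|[x u] s IHs] /=; first exact: te_refl.
rewrite -cat1s -[X in tensor_eq _ X]cats0; apply: te_cat => //.
by apply: te_trans (te_sym (te_scale _ _ _)) _; rewrite scale0r; apply: te_0l.
Qed.

Let scale1 : left_id 1 tensor_scale.
Proof.
move=> p; rewrite -(tensor_classK p) tensor_class_scale; congr tensor_class.
by rewrite -[RHS]map_id; apply: eq_map => -[x u] /=; rewrite scale1r.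
Qed.

Let addN : left_inverse tensor_zero tensor_opp tensor_add.
Proof. by move=> p; rewrite -{2}(scale1 p) -scaleDl addNr scale0. Qed.

HB.instance Definition _ := GRing.isZmodule.Build tensor addA addC add0 addN.

Let scaleA c d p : tensor_scale c (tensor_scale d p) = tensor_scale (c * d) p.
Proof.
rewrite -(tensor_classK p) !tensor_class_scale; congr tensor_class.
by rewrite /scale_seq -map_comp; apply: eq_map => -[x u] /=; rewrite scalerA.
Qed.

Let scaleDr : right_distributive tensor_scale +%R.
Proof.
move=> c p q; rewrite -(tensor_classK p) -(tensor_classK q).
rewrite [_ + _]tensor_class_cat !tensor_class_scale /scale_seq map_cat.
by rewrite [RHS]tensor_class_cat.
Qed.

HB.instance Definition _ :=
  GRing.Zmodule_isLmodule.Build K tensor scaleA scale1 scaleDr scaleDl.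

End Tensor.

(* The conjugate module: same group, scalars acting through conjugation. *)
Definition conj_mod (R : realDomainType) (X : lmodType (cplx R)) : Type := X.

Section ConjMod.
Variables (R : realDomainType) (X : lmodType (cplx R)).

HB.instance Definition _ := GRing.Zmodule.copy (conj_mod X) X.

Definition conj_scale (c : cplx R) (x : conj_mod X) : conj_mod X :=
  cplx_conj c *: (x : X).

Let conj_scaleA c d x : conj_scale c (conj_scale d x) = conj_scale (c * d) x.
Proof. by rewrite /conj_scale scalerA cplx_conjM. Qed.

Let conj_scale1 : left_id 1 conj_scale.
Proof. by move=> x; rewrite /conj_scale cplx_conj1 scale1r. Qed.

Let conj_scaleDr : right_distributive conj_scale +%R.
Proof. by move=> c x y; rewrite /conj_scale -scalerDr. Qed.

Let conj_scaleDl x : {morph conj_scale^~ x : c d / c + d}.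
Proof. by move=> c d; rewrite /conj_scale cplx_conjD scalerDl. Qed.

HB.instance Definition _ := GRing.Zmodule_isLmodule.Build (cplx R) (conj_mod X)
  conj_scaleA conj_scale1 conj_scaleDr conj_scaleDl.

End ConjMod.

Section Morita.
Variable R : realDomainType.
Notation C := (cplx R).

(* A Hermitian form on the tensor product is determined by its
   values on pure tensors, so [F] is "the" form given by the formula. *)
Definition tensor_positive (A : starAlgType R) (X : lmodType C)
    (ract : X -> A -> X) (ip : X -> X -> A) : Prop :=
  forall (H : preHilbert R) (pi : starRep A H),
    exists F : tensor ract pi -> tensor ract pi -> C,
      (forall x y u v,
         F (tensor_pure ract pi x u) (tensor_pure ract pi y v)
           = ph_ip u (pi (ip x y) v)) /\
      positive_semidefinite F.

Definition spans (X : Type) (A : starAlgType R) (ip : X -> X -> A) : Prop :=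
  forall a, exists s : seq (C * X * X), a = \sum_(p <- s) p.1.1 *: ip p.1.2 p.2.

(* The right B-action on the conjugate bimodule. *)
Definition conj_ract (B : starAlgType R) (X : lmodType C) (lact : B -> X -> X)
  (x : conj_mod X) (b : B) : conj_mod X := lact b^† x.

Record equivalence_bimodule (B A : starAlgType R) := EquivalenceBimodule {
  eb_mod :> lmodType C;
  eb_lact : B -> eb_mod -> eb_mod;
  eb_ract : eb_mod -> A -> eb_mod;
  eb_ipr : eb_mod -> eb_mod -> A;
  eb_ipl : eb_mod -> eb_mod -> B;

  eb_lact_linearl : forall (c : C) b b' x,
    eb_lact (c *: b + b') x = c *: eb_lact b x + eb_lact b' x;
  eb_lact_linearr : forall (c : C) b x y,
    eb_lact b (c *: x + y) = c *: eb_lact b x + eb_lact b y;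
  eb_lactM : forall b b' x, eb_lact (b ** b') x = eb_lact b (eb_lact b' x);
  eb_ract_linearl : forall (c : C) x y a,
    eb_ract (c *: x + y) a = c *: eb_ract x a + eb_ract y a;
  eb_ract_linearr : forall (c : C) x a a',
    eb_ract x (c *: a + a') = c *: eb_ract x a + eb_ract x a';
  eb_ractM : forall x a a', eb_ract x (a ** a') = eb_ract (eb_ract x a) a';
  eb_actA : forall b x a, eb_ract (eb_lact b x) a = eb_lact b (eb_ract x a);

  eb_ipr_linear : forall x, linear (eb_ipr x);
  eb_ipr_herm : forall x y, eb_ipr x y = (eb_ipr y x)^†;
  eb_ipr_ract : forall x y a, eb_ipr x (eb_ract y a) = eb_ipr x y ** a;
  eb_ipr_ge0 : forall x, positive_element (eb_ipr x x);
  eb_ipr_lact : forall x y b, eb_ipr x (eb_lact b y) = eb_ipr (eb_lact b^† x) y;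
  eb_ipr_full : spans eb_ipr;

  eb_ipl_linear : forall y, linear (eb_ipl^~ y);
  eb_ipl_herm : forall x y, eb_ipl x y = (eb_ipl y x)^†;
  eb_ipl_lact : forall x y b, eb_ipl (eb_lact b x) y = b ** eb_ipl x y;
  eb_ipl_ge0 : forall x, positive_element (eb_ipl x x);
  eb_ipl_ract : forall x y a, eb_ipl (eb_ract x a) y = eb_ipl x (eb_ract y a^†);
  eb_ipl_full : spans eb_ipl;

  eb_compat : forall x y z, eb_lact (eb_ipl x y) z = eb_ract x (eb_ipr y z);

  eb_tensor_positive : tensor_positive eb_ract eb_ipr;
  eb_conj_tensor_positive : tensor_positive (X := conj_mod eb_mod) (conj_ract eb_lact) eb_ipl
}.

Definition formally_Morita_equivalent (A B : starAlgType R) : Prop :=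
  inhabited (equivalence_bimodule B A).

End Morita.

(* Main.v *)
Require Import Defs.
From HB Require Import structures.
From mathcomp Require Import all_boot all_order all_algebra.

(* The bimodule is A itself, with b . x = Phi(b) x, <x, y>_A = x^* y and
   _B<x, y> = Phi^-1 (x y^* ).  The approximate identity enters only through
   a = E^* a and a = a E^*, which make both inner products full.  Condition P
   holds because x (x) u |-> pi(x) u maps A (x)_A H into H and pulls the inner
   product of H back to the form in question; condition Q is the same argument
   for x (x) u |-> pi(Phi^-1 (x^* )) u. *)

Set Implicit Arguments.
Unset Strict Implicit.
Unset Printing Implicit Defensive.

Import GRing.Theory.
Local Open Scope ring_scope.

Section TensorPositive.
Variables (R : realDomainType) (A : starAlgType R).
Notation C := (cplx R).

Section Evaluation.
Variables (H : preHilbert R) (pi : starRep A H).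

(** With the vector as a parameter, linearity in the algebra element becomes a canonical structure
    usable by [linear0], [linearD] and [linearZ]. *)
Definition rep_at (u : H) (a : A) : H := pi a u.
HB.instance Definition _ u := GRing.isLinear.Build C A H *:%R (rep_at u)
  (fun c a b => rep_linear pi c a b u).

Variables (X : lmodType C) (ract : X -> A -> X) (T : {linear X -> A}).
Hypothesis T_ract : forall x a, T (ract x a) = T x ** a.

Definition eval_seq (s : seq (X * H)) : H := \sum_(p <- s) rep_at p.2 (T p.1).

(** By induction on the generators of the congruence; [T_ract] enters only for [te_act], where it
    moves [a] across the tensor sign. *)
Lemma eval_seq_eq s t : tensor_eq ract pi s t -> eval_seq s = eval_seq t.
Proof.
rewrite /eval_seq; elim=> {s t} //.
- by move=> s t u _ -> _ ->.
- by move=> s s' t t' _ es _ et; rewrite !big_cat /= es et.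
- by move=> s t; rewrite !big_cat /= addrC.
- by move=> u; rewrite big_seq1 big_nil /= !linear0.
- by move=> x y u; rewrite !big_cons !big_nil !addr0 linearD /= linearD.
- by move=> x u v; rewrite !big_cons !big_nil !addr0 /rep_at /= linearD.
- by move=> c x u; rewrite !big_seq1 /= !linearZ /rep_at /= linearZ.
- by move=> a x u; rewrite !big_seq1 /= /rep_at T_ract rep_mul.
Qed.

Definition eval (p : tensor ract pi) : H := eval_seq (repr p).

Lemma eval_class s : eval (tensor_class ract pi s) = eval_seq s.
Proof. by apply: eval_seq_eq; apply: tensor_repr. Qed.

Lemma eval_linear : linear eval.
Proof.
(* Sums and multiples in [tensor] are by definition classes of sequences built from representatives,
   so [eval_class] applies up to conversion. *)
move=> c p q; rewrite [LHS]eval_class /eval_seq big_cat /=; congr (_ + _).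
rewrite [LHS]eval_class /eval_seq /scale_seq big_map scaler_sumr.
by apply: eq_bigr => -[x u] _; rewrite /rep_at /= linearZ.
Qed.

End Evaluation.

(** The form is the pullback of [ph_ip] along [eval T]; on pure tensors, [rep_star] moves [pi (T x)]
    to the other side as [pi (T x)^†]. A general [T] lets P and Q share the argument. *)
Lemma tensor_positive_factor (X : lmodType C) (ract : X -> A -> X)
    (ip : X -> X -> A) (T : {linear X -> A}) :
  (forall x a, T (ract x a) = T x ** a) ->
  (forall x y, ip x y = (T x)^† ** T y) ->
  tensor_positive ract ip.
Proof.
move=> T_ract ipE H pi; have [[ip_lin ip_herm] ip_ge0] := ph_psd H.
exists (fun p q => ph_ip (eval T p) (eval T q)); split.
  move=> x y u v; rewrite /tensor_pure !(eval_class pi T_ract) /eval_seq !big_seq1.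
  by rewrite /= /rep_at ipE rep_mul (rep_star pi).
split; last by move=> p; apply: ip_ge0.
split=> [p c q r | p q]; last exact: ip_herm.
by rewrite (eval_linear T_ract) ip_lin.
Qed.

End TensorPositive.

Section SquaresAndSpans.
Variables (R : realDomainType) (A : starAlgType R).

Lemma positive_square (a : A) : positive_element (a^† ** a).
Proof. by split=> [|w w_pos]; [rewrite starM starK | apply: w_pos]. Qed.

Lemma spans_onto (X : Type) (ip : X -> X -> A) :
  (forall a, exists x y, a = ip x y) -> spans ip.
Proof.
move=> onto a; have [x [y ->]] := onto a.
by exists [:: (1, x, y)]; rewrite big_seq1 scale1r.
Qed.

Lemma approximate_unit : has_approximate_identity A ->
  forall a : A, exists e : A, [/\ e^† = e, e ** a = a & a ** e = a].
Proof.
move=> [d [I [S [E aiE]]]] a; have [i Sa] := ai_cover aiE a.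
have [Ea aE] := ai_unit aiE Sa.
by exists (E i); split; rewrite -?(ai_herm aiE).
Qed.

(** Two conjugations cancel: one from the scalar action on [conj_mod A], one from the antilinear
    star. *)
Lemma star_conj_linear : linear (fun x : conj_mod A => (x : A)^† : A).
Proof.
move=> c x y; rewrite [LHS]starD [X in X + _ = _]starZ; congr (_ *: _ + _).
by case: c => a b; congr complex.Complex; apply: opprK.
Qed.

End SquaresAndSpans.

Lemma Morita_of_isomorphism (R : realDomainType) (A B : starAlgType R)
    (Phi : {linear B -> A}) :
  has_approximate_identity A -> star_isomorphism Phi ->
  formally_Morita_equivalent A B.
Proof.
move=> hA [[Psi PhiK PsiK] PhiM PhiS].
have Psi_lin : linear Psi := can2_linear PhiK PsiK.
have PsiM x y : Psi (x ** y) = Psi x ** Psi y.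
  by apply: (can_inj PhiK); rewrite PhiM !PsiK.
have PsiS x : Psi x^† = (Psi x)^†.
  by apply: (can_inj PhiK); rewrite PhiS !PsiK.
(* The star turns the conjugate action, left multiplication by [Phi b^†], into right multiplication
   by [b] after [Psi]. *)
pose sPsi (x : conj_mod A) : B := Psi (x : A)^†.
have sPsi_lin : linear sPsi.
  by move=> c x y; rewrite /sPsi (star_conj_linear (A := A)) Psi_lin.
pose T : {linear conj_mod A -> B} :=
  HB.pack sPsi (GRing.isLinear.Build _ _ _ _ _ sPsi_lin).
constructor.
apply: (@EquivalenceBimodule R B A A (fun b x => Phi b ** x) (fun x a => x ** a)
  (fun x y => x^† ** y) (fun x y => Psi (x ** y^†))).
- by move=> c b b' x; rewrite linearP smulDl smulZl.
- by move=> c b x y; rewrite smulDr smulZr.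
- by move=> b b' x; rewrite PhiM smulA.
- by move=> c x y a; rewrite smulDl smulZl.
- by move=> c x a a'; rewrite smulDr smulZr.
- by move=> x a a'; rewrite smulA.
- by move=> b x a; rewrite smulA.
- by move=> x c y z; rewrite smulDr smulZr.
- by move=> x y; rewrite starM starK.
- by move=> x y a; rewrite smulA.
- exact: positive_square.
- by move=> x y b; rewrite starM PhiS starK smulA.
- apply: spans_onto => a; have [e [es ea _]] := approximate_unit hA a.
  by exists e, a; rewrite es ea.
- by move=> y c x z; rewrite smulDl smulZl Psi_lin.
- by move=> x y; rewrite -PsiS starM starK.
- by move=> x y b; rewrite -smulA PsiM PhiK.
(* The double star exhibits the element as [b^† ** b] with [b = Psi x^†]. *)
- by move=> x; rewrite -{1}(starK x) PsiM PsiS; apply: positive_square.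
- by move=> x y a; rewrite starM starK smulA.
- apply: spans_onto => b; have [e [es _ ae]] := approximate_unit hA (Phi b).
  by exists (Phi b), e; rewrite es ae PhiK.
- by move=> x y z; rewrite PsiK smulA.
- exact: (tensor_positive_factor (T := idfun)).
- apply: (tensor_positive_factor (T := T)) => [x b | x y] /=; rewrite /sPsi.
    by rewrite /conj_ract starM PsiM -PhiS starK PhiK.
  by rewrite -PsiS starK PsiM.
Qed.

Theorem proposition5p4 (R : realDomainType) (A : starAlgType R)
    (hA : has_approximate_identity A) :
  (forall (B : starAlgType R) (Phi : {linear B -> A}),
     star_isomorphism Phi -> formally_Morita_equivalent A B) /\
  formally_Morita_equivalent A A.
Proof.
split=> [B Phi|]; first exact: Morita_of_isomorphism.
by apply: (@Morita_of_isomorphism _ _ _ idfun) => //; split=> //; exists id.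
Qed.
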